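(* Let $\lambda_0,\lambda_1\in\mathcal M_2(\mathfrak C_\Omega)$ with $\lambda_0(\mathfrak C_\Omega)=\lambda_1(\mathfrak C_\Omega)$. (a) The function $[0,\infty[\,\ni\kappa\mapsto w(\lambda_0,\lambda_1,\kappa):=\mathsf W_{\mathfrak C}(\kappa\delta_{\mathfrak o}+\lambda_0,\kappa\delta_{\mathfrak o}+\lambda_1)$ is nonincreasing. (b) Define $\theta_j:=\lambda_j(\mathfrak C_\Omega\setminus\{\mathfrak o\})$, $\rho_j:=\lambda_j(\{\mathfrak o\})$ for $j=0,1$, and $\kappa_*:=\max\{0,\theta_1-\rho_0,\theta_0-\rho_1\}$. Then for all $\kappa\ge\kappa_*$ we have $w(\lambda_0,\lambda_1,\kappa)=w(\lambda_0,\lambda_1,\kappa_* )$, and the optimal transport plans for $\kappa$ and for $\kappa_*$ differ only by $(\kappa-\kappa_* )\delta_{(\mathfrak o,\mathfrak o)}$: the optimal plans for the pair $(\kappa\delta_{\mathfrak o}+\lambda_0,\kappa\delta_{\mathfrak o}+\lambda_1)$ are exactly the measures $\gamma+(\kappa-\kappa_* )\delta_{(\mathfrak o,\mathfrak o)}$ with $\gamma$ an optimal plan for $(\kappa_*\delta_{\mathfrak o}+\lambda_0,\kappa_*\delta_{\mathfrak o}+\lambda_1)$. (c) For any optimal transport plan $\gamma$ connecting $\kappa_*\delta_{\mathfrak o}+\lambda_0$ and $\kappa_*\delta_{\mathfrak o}+\lambda_1$ we have $\gamma(\mathfrak N)=0$, where $$\mathfrak N:=\big\{([x_0,r_0],[x_1,r_1])\in\mathfrak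 C_\Omega\times\mathfrak C_\Omega\ \big|\ r_0,r_1>0,\ |x_0-x_1|>\pi/2\big\}.$$
   Context: $\Omega\subset\mathbb R^d$ is convex and compact. The cone over $\Omega$ is $\mathfrak C_\Omega:=(\Omega\times[0,\infty[)/(\Omega\times\{0\})$; its points are written $[x,r]$, and $\mathfrak o=[x,0]$ denotes the tip. It carries the complete metric $$\mathsf d_{\mathfrak C}([x_0,r_0],[x_1,r_1])^2=r_0^2+r_1^2-2r_0r_1\cos_\pi(|x_0-x_1|),\qquad \cos_\pi(L)=\cos(\min\{L,\pi\}).$$ $\mathcal M_2(\mathfrak C_\Omega)$ is the set of finite nonnegative Borel measures $\lambda$ on $\mathfrak C_\Omega$ with $\int r^2\,\mathrm d\lambda([x,r])<\infty$. For $\lambda_0,\lambda_1$ of equal mass, $$\mathsf W_{\mathfrak C}(\lambda_0,\lambda_1)^2:=\inf\Big\{\iint\mathsf d_{\mathfrak C}(z_0,z_1)^2\,\mathrm d\gamma(z_0,z_1)\ \Big|\ \gamma\in\mathcal M(\mathfrak C_\Omega\times\mathfrak C_\Omega),\ \Pi^i_\#\gamma=\lambda_i,\ i=0,1\Big\},$$ where $\mathcal M$ denotes finite nonnegative Borel measures and $\Pi^0,\Pi^1$ the projections on the first and second factor. An optimal (transport) plan is a minimizer $\gamma$. *)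

(* Defs.v *)
From HB Require Import structures.
From mathcomp Require Import all_boot all_order all_algebra.
From mathcomp Require Import all_classical all_reals all_analysis.
From mathcomp Require Import ring lra.

Set Implicit Arguments.
Unset Strict Implicit.
Unset Printing Implicit Defensive.

Import Order.TTheory GRing.Theory Num.Theory.
Import numFieldNormedType.Exports.

Local Open Scope classical_set_scope.
Local Open Scope ring_scope.
Local Open Scope quotient_scope.

(* The norm that the library puts on 'rV[R]_d is the sup norm; the topology
   is the same. *)
Section euclidean_norm.
Context {R : realType} {d : nat}.
Implicit Types u v : 'rV[R]_d.

Definition enorm u : R := Num.sqrt (\sum_i u ord0 i ^+ 2).

Lemma enorm_ge0 u : 0 <= enorm u.
Proof. exact: sqrtr_ge0. Qed.

Lemma sqr_enorm u : enorm u ^+ 2 = \sum_i u ord0 i ^+ 2.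
Proof. by rewrite sqr_sqrtr// sumr_ge0// => i _; exact: sqr_ge0. Qed.

Lemma enorm0 : enorm 0 = 0.
Proof.
by rewrite /enorm big1 ?sqrtr0// => i _; rewrite mxE expr0n.
Qed.

Lemma enorm_eq0 u : enorm u = 0 -> u = 0.
Proof.
move=> /(congr1 (fun x => x ^+ 2)); rewrite sqr_enorm expr0n/= => /eqP.
rewrite psumr_eq0 => [/allP u0|i _]; last exact: sqr_ge0.
apply/rowP => i; rewrite mxE; apply/eqP.
by have := u0 i (mem_index_enum _); rewrite sqrf_eq0.
Qed.

Lemma enormN u : enorm (- u) = enorm u.
Proof. by congr Num.sqrt; apply: eq_bigr => i _; rewrite mxE sqrrN. Qed.

Lemma enormB u v : enorm (u - v) = enorm (v - u).
Proof. by rewrite -enormN opprB. Qed.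

Lemma cauchy_schwarz u v :
  \sum_i u ord0 i * v ord0 i <= enorm u * enorm v.
Proof.
have [/enorm_eq0 ->|u0] := eqVneq (enorm u) 0.
  by rewrite enorm0 mul0r big1// => i _; rewrite mxE mul0r.
have [/enorm_eq0 ->|v0] := eqVneq (enorm v) 0.
  by rewrite enorm0 mulr0 big1// => i _; rewrite mxE mulr0.
have {}u0 : 0 < enorm u by rewrite lt_neqAle eq_sym u0 enorm_ge0.
have {}v0 : 0 < enorm v by rewrite lt_neqAle eq_sym v0 enorm_ge0.
have : 0 <= \sum_i (enorm v * u ord0 i - enorm u * v ord0 i) ^+ 2.
  by apply: sumr_ge0 => i _; exact: sqr_ge0.
have -> : \sum_i (enorm v * u ord0 i - enorm u * v ord0 i) ^+ 2 =
    enorm v ^+ 2 * \sum_i u ord0 i ^+ 2 + enorm u ^+ 2 * \sum_i v ord0 i ^+ 2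
    - (enorm u * enorm v) * 2 * \sum_i u ord0 i * v ord0 i.
  rewrite !mulr_sumr -big_split/= -sumrB; apply: eq_bigr => i _; ring.
rewrite -!sqr_enorm subr_ge0 => H.
rewrite -(ler_pM2l (_ : 0 < enorm u * enorm v * 2)); last first.
  by rewrite !mulr_gt0.
by apply: le_trans H _; rewrite le_eqVlt; apply/orP; left; apply/eqP; ring.
Qed.

Lemma ler_enormD u v : enorm (u + v) <= enorm u + enorm v.
Proof.
rewrite -(@ler_pXn2r _ 2%N)// ?nnegrE ?addr_ge0 ?enorm_ge0// sqr_enorm.
have -> : \sum_i (u + v) ord0 i ^+ 2 = \sum_i u ord0 i ^+ 2 +
    \sum_i v ord0 i ^+ 2 + 2 * \sum_i u ord0 i * v ord0 i.
  rewrite mulr_sumr -!big_split/=; apply: eq_bigr => i _; rewrite mxE; ring.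
by rewrite -!sqr_enorm; have := cauchy_schwarz u v; lra.
Qed.

Lemma ler_enorm_distD u v w : enorm (u - w) <= enorm (u - v) + enorm (v - w).
Proof.
by apply: le_trans (ler_enormD _ _); rewrite addrA subrK.
Qed.

End euclidean_norm.

Section cone_formula.
Context {R : realType}.
Implicit Types r s t a b c L : R.

Definition cos_pi L : R := cos (Num.min L pi).

Definition cone_sqdist r s L : R := r ^+ 2 + s ^+ 2 - 2 * r * s * cos_pi L.

Lemma cone_sqdist_ge0 r s L : 0 <= r -> 0 <= s -> 0 <= cone_sqdist r s L.
Proof.
move=> r0 s0; have : 0 <= r * s * (1 - cos_pi L).
  by rewrite !mulr_ge0// subr_ge0 cos_le1.
have := sqr_ge0 (r - s); rewrite /cone_sqdist; nra.
Qed.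

Lemma minpi_itv L : 0 <= L -> Num.min L pi \in `[0, pi]%R :> bool.
Proof. by move=> L0; rewrite in_itv/= le_min L0 pi_ge0 ge_min lexx orbT. Qed.

Let plane r s a : R := Num.sqrt (r ^+ 2 + s ^+ 2 - 2 * r * s * cos a).

Let le_plane r s a b : 0 <= r -> 0 <= s ->
  a \in `[0, pi] -> b \in `[0, pi] -> a <= b -> plane r s a <= plane r s b.
Proof.
move=> r0 s0 aP bP ab; apply: ler_wsqrtr.
rewrite lerD2l lerN2 ler_wpM2l ?mulr_ge0//.
have [->//|ab'] := eqVneq a b.
by rewrite ltW// ltr_cos// lt_neqAle ab' ab.
Qed.

Let vec2 (x y : R) : 'rV[R]_2 := \row_(i < 2) if i == ord0 then x else y.

Let enorm_vec2 x y : enorm (vec2 x y) = Num.sqrt (x ^+ 2 + y ^+ 2).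
Proof. by rewrite /enorm !big_ord_recl big_ord0 !mxE/= addr0. Qed.

Let plane_triangle r s t a b :
  plane r t (a + b) <= plane r s a + plane s t b.
Proof.
have -> : plane r s a = enorm (vec2 (r * cos a - s) (- (r * sin a))).
  rewrite enorm_vec2; congr Num.sqrt.
  by have := cos2Dsin2 a; nra.
have -> : plane s t b = enorm (vec2 (s - t * cos b) (- (t * sin b))).
  rewrite enorm_vec2; congr Num.sqrt.
  by have := cos2Dsin2 b; nra.
have -> : plane r t (a + b) =
    enorm (vec2 (r * cos a - s) (- (r * sin a)) +
           vec2 (s - t * cos b) (- (t * sin b))).
  rewrite (_ : _ + _ = vec2 (r * cos a - t * cos b)
                            (- (r * sin a) - t * sin b)); last first.
    by apply/rowP => i; rewrite !mxE; case: ifP => _ //; rewrite addrA subrK.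
  rewrite enorm_vec2 /plane cosD; congr Num.sqrt.
  have ca := cos2Dsin2 a; have cb := cos2Dsin2 b.
  transitivity (r ^+ 2 * (cos a ^+ 2 + sin a ^+ 2) +
    t ^+ 2 * (cos b ^+ 2 + sin b ^+ 2) -
    2 * r * t * (cos a * cos b - sin a * sin b)); last by ring.
  by rewrite ca cb !mulr1.
exact: ler_enormD.
Qed.

Lemma cone_sqdist_triangle r s t a b c : 0 <= r -> 0 <= s -> 0 <= t ->
  0 <= a -> 0 <= b -> 0 <= c -> c <= a + b ->
  Num.sqrt (cone_sqdist r t c) <=
  Num.sqrt (cone_sqdist r s a) + Num.sqrt (cone_sqdist s t b).
Proof.
move=> r0 s0 t0 a0 b0 c0 cab.
rewrite -!/(plane _ _ _).
have := minpi_itv a0; have := minpi_itv b0; have := minpi_itv c0.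
have : Num.min c pi <= Num.min a pi + Num.min b pi.
  have p0 := pi_ge0 R.
  case: (leP a pi) => // ap; case: (leP b pi) => // bp;
    case: (leP c pi) => // cp; lra.
move: (Num.min a pi) (Num.min b pi) (Num.min c pi) => a' b' c' cab' cP bP aP.
have [abp|abp] := leP (a' + b') pi.
  apply: le_trans (plane_triangle r s t a' b').
  apply: le_plane => //; move: aP bP; rewrite !in_itv/= => /andP[? ?] /andP[? ?].
  by rewrite addr_ge0.
apply: (@le_trans _ _ (plane r t (a' + (pi - a')))).
  apply: le_plane => //; move: cP; rewrite !in_itv/= addrC subrK ?lexx ?pi_ge0//.
  by move=> /andP[].
apply: (le_trans (plane_triangle r s t a' (pi - a'))).
rewrite lerD2l; apply: le_plane => //; last by lra.
by move: aP; rewrite !in_itv/= => /andP[? ?]; apply/andP; split; lra.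
Qed.

Lemma cone_sqdist_eq0 r s a : 0 <= r -> 0 <= s -> 0 <= a ->
  cone_sqdist r s a = 0 -> r = s /\ (r = 0 \/ a = 0).
Proof.
move=> r0 s0 a0 H.
have c1 : 0 <= r * s * (1 - cos_pi a).
  by rewrite !mulr_ge0// subr_ge0 cos_le1.
have rs2 : (r - s) ^+ 2 = 0.
  apply/eqP; rewrite eq_le sqr_ge0 andbT.
  by move: H c1; rewrite /cone_sqdist; nra.
have rs : r = s.
  by apply/eqP; move/eqP: rs2; rewrite sqrf_eq0 subr_eq0.
split=> //; have [->|rn0] := eqVneq r 0; [by left|right].
have rc : r * r * (1 - cos_pi a) = 0.
  by move: H; rewrite /cone_sqdist -rs; nra.
have ca : cos_pi a = cos 0.
  rewrite cos0; apply/eqP; rewrite eq_sym -subr_eq0.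
  by move/eqP: rc; rewrite !mulf_eq0 (negbTE rn0).
have : Num.min a pi = 0.
  apply: cos_inj => //; first exact: minpi_itv.
  by rewrite in_itv/= lexx pi_ge0.
by have := pi_gt0 R; case: (leP a pi) => // _ p0 pE; rewrite pE ltxx in p0.
Qed.

End cone_formula.

(* cone is the quotient (Omega x [0,oo[) / (Omega x {0}). Its parameter is a
   proof that Omega is nonempty because measurable types are pointed in the
   library; the distinguished point is the tip. Functions on the quotient are
   read off canonical representatives; radiusE, tipE and cone_distE state that
   they do not depend on them. *)
Section cone.
Context {R : realType} {d : nat} {Omega : set 'rV[R]_d}.

Definition cone_equiv (p q : set_type Omega * {nonneg R}) : bool :=
  (p == q) || (p.2%:num == 0) && (q.2%:num == 0).

Lemma cone_equiv_refl : reflexive cone_equiv.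
Proof. by move=> p; rewrite /cone_equiv eqxx. Qed.

Lemma cone_equiv_sym : symmetric cone_equiv.
Proof. by move=> p q; rewrite /cone_equiv eq_sym andbC. Qed.

Lemma cone_equiv_trans : transitive cone_equiv.
Proof.
move=> q p s /orP[/eqP ->//|/andP[p0 q0]] /orP[/eqP <-|/andP[_ s0]].
  by rewrite /cone_equiv p0 q0 orbT.
by rewrite /cone_equiv p0 s0 orbT.
Qed.

Canonical cone_equiv_rel :=
  EquivRel cone_equiv cone_equiv_refl cone_equiv_sym cone_equiv_trans.

Definition cone (Omega0 : Omega !=set0) : Type := {eq_quot cone_equiv_rel}.

Context {Omega0 : Omega !=set0}.
Local Notation C := (cone Omega0).

HB.instance Definition _ := Choice.on C.
HB.instance Definition _ := EqQuotient.on C.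

Definition cone_pt (x : set_type Omega) (r : {nonneg R}) : C := \pi_C (x, r).

Definition tip : C :=
  let: exist x Ox := cid Omega0 in cone_pt (exist _ x (mem_set Ox)) 0%:nng.

Definition radius (z : C) : R := (repr z).2%:num.

Definition cone_dist (z0 z1 : C) : R :=
  let: (x0, r0) := repr z0 in
  let: (x1, r1) := repr z1 in
  Num.sqrt (cone_sqdist r0%:num r1%:num (enorm (\val x0 - \val x1))).

Lemma cone_ptP z : exists x r, z = cone_pt x r.
Proof.
by exists (repr z).1, (repr z).2; rewrite /cone_pt -surjective_pairing reprK.
Qed.

Lemma cone_pt_eq x r y s :
  cone_pt x r = cone_pt y s <->
  (x = y /\ r = s) \/ (r%:num = 0 /\ s%:num = 0).
Proof.
split=> [/eqmodP/orP[/eqP[-> ->]|/andP[/eqP ? /eqP ?]]|]; [by left|by right|].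
move=> [[-> ->]//|[/eqP r0 /eqP s0]]; apply/eqmodP.
by rewrite /= /cone_equiv/= r0 s0 orbT.
Qed.

Lemma radiusE x r : radius (cone_pt x r) = r%:num.
Proof.
rewrite /radius; case E : (repr _) => [y s] /=.
have : cone_pt y s = cone_pt x r by rewrite /cone_pt -E reprK.
by move/cone_pt_eq => [[_ ->//]|[-> ->]].
Qed.

Lemma radius_ge0 z : 0 <= radius z.
Proof. by rewrite /radius. Qed.

Lemma tipE x : tip = cone_pt x 0%:nng.
Proof. by rewrite /tip; case: cid => y Oy; apply/cone_pt_eq; right. Qed.

Lemma tipP z : z = tip <-> radius z = 0.
Proof.
have [x [r ->]] := cone_ptP z; rewrite (tipE x) radiusE; split.
  by move=> /cone_pt_eq[[_ ->]|[]].
by move=> r0; apply/cone_pt_eq; right.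
Qed.

Lemma cone_distE x r y s : cone_dist (cone_pt x r) (cone_pt y s) =
  Num.sqrt (cone_sqdist r%:num s%:num (enorm (\val x - \val y))).
Proof.
rewrite /cone_dist.
case E : (repr (cone_pt x r)) => [x' r'].
case F : (repr (cone_pt y s)) => [y' s'].
have : cone_pt x' r' = cone_pt x r by rewrite /cone_pt -E reprK.
have : cone_pt y' s' = cone_pt y s by rewrite /cone_pt -F reprK.
rewrite /cone_sqdist.
move=> /cone_pt_eq[[-> ->]|[-> ->]] /cone_pt_eq[[-> ->]|[-> ->]] //;
  by rewrite ?(mul0r, mulr0).
Qed.

Lemma sqr_cone_distE x r y s : cone_dist (cone_pt x r) (cone_pt y s) ^+ 2 =
  r%:num ^+ 2 + s%:num ^+ 2 -
  2 * r%:num * s%:num * cos_pi (enorm (\val x - \val y)).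
Proof. by rewrite cone_distE sqr_sqrtr ?cone_sqdist_ge0. Qed.

Lemma cone_distxx z : cone_dist z z = 0.
Proof.
have [x [r ->]] := cone_ptP z; rewrite cone_distE subrr enorm0.
rewrite /cone_sqdist /cos_pi min_l ?pi_ge0// cos0 (_ : _ - _ = 0) ?sqrtr0//.
by ring.
Qed.

Lemma cone_dist_positivity z0 z1 : cone_dist z0 z1 = 0 -> z0 = z1.
Proof.
have [x [r ->]] := cone_ptP z0; have [y [s ->]] := cone_ptP z1.
rewrite cone_distE => /eqP; rewrite sqrtr_eq0 => H.
have /cone_sqdist_eq0[//|//||rs E] : cone_sqdist r%:num s%:num
    (enorm (\val x - \val y)) = 0.
  by apply/eqP; rewrite eq_le H cone_sqdist_ge0.
  exact: enorm_ge0.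
apply/cone_pt_eq; case: E => [r0|/enorm_eq0/eqP]; first by right; rewrite -rs.
by rewrite subr_eq0 => /eqP/val_inj ->; left; split=> //; exact/val_inj.
Qed.

Lemma cone_dist_sym z0 z1 : cone_dist z0 z1 = cone_dist z1 z0.
Proof.
have [x [r ->]] := cone_ptP z0; have [y [s ->]] := cone_ptP z1.
rewrite !cone_distE enormB /cone_sqdist; congr Num.sqrt; ring.
Qed.

Lemma cone_dist_triangle z1 z0 z2 :
  cone_dist z0 z2 <= cone_dist z0 z1 + cone_dist z1 z2.
Proof.
have [x [r ->]] := cone_ptP z0; have [y [s ->]] := cone_ptP z1.
have [w [t ->]] := cone_ptP z2; rewrite !cone_distE.
by apply: cone_sqdist_triangle; rewrite ?enorm_ge0 ?ler_enorm_distD.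
Qed.

HB.instance Definition _ := isPointed.Build C tip.
HB.instance Definition _ := @isMetric.Build R C cone_dist
  cone_distxx cone_dist_positivity cone_dist_sym cone_dist_triangle.

Lemma mdist_coneE z0 z1 : mdist z0 z1 = cone_dist z0 z1.
Proof. by []. Qed.

Lemma open_coneP (A : set C) : open A <->
  forall z, A z -> exists2 e : R, 0 < e & [set y | cone_dist z y < e] `<=` A.
Proof.
rewrite openE; split => [Ao z /Ao|Ao z /Ao].
  rewrite /interior => /nbhs_ballP[e e0 eA]; exists e => // y; apply: eA.
move=> [e e0 eA]; by apply/nbhs_ballP; exists e => // y; apply: eA.
Qed.

End cone.

Arguments tip {R d Omega Omega0}.

Notation borel T := (g_sigma_algebraType (@open T%type)).

(* Library measures are functions on all sets, but only their values on the
   measurable ones are meaningful. *)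
Definition same_measure (disp : measure_display) (T : measurableType disp)
    (R : realType) (mu nu : set T -> \bar R) : Prop :=
  forall A, measurable A -> mu A = nu A.

Section transport.
Context {R : realType} {d : nat} {Omega : set 'rV[R]_d}
  {Omega0 : Omega !=set0}.
Local Notation C := (cone Omega0).
Local Open Scope ereal_scope.

Definition M2 : set {finite_measure set (borel C) -> \bar R} :=
  [set l | \int[l]_(z in [set: borel C]) (radius (z : C) ^+ 2)%:E < +oo].

Definition plans (l0 l1 : {measure set (borel C) -> \bar R}) :
    set {finite_measure set (borel (C * C)) -> \bar R} :=
  [set g | same_measure (pushforward g (fst : borel (C * C) -> borel C)) l0
         /\ same_measure (pushforward g (snd : borel (C * C) -> borel C)) l1].

Definition cost (g : {measure set (borel (C * C)) -> \bar R}) : \bar R :=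
  \int[g]_(z in [set: borel (C * C)]) (cone_dist (z.1 : C) (z.2 : C) ^+ 2)%:E.

Definition WC (l0 l1 : {measure set (borel C) -> \bar R}) : \bar R :=
  sqrte (ereal_inf [set cost g | g in plans l0 l1]).

Definition optimal_plan (l0 l1 : {measure set (borel C) -> \bar R})
    (g : {finite_measure set (borel (C * C)) -> \bar R}) : Prop :=
  plans l0 l1 g /\ forall g', plans l0 l1 g' -> cost g <= cost g'.

Definition tip_tip : borel (C * C) := (tip, tip).

Definition add_tip (k : {nonneg R}) (l : {measure set (borel C) -> \bar R}) :
    {measure set (borel C) -> \bar R} :=
  measure_add (mscale k (@dirac _ (borel C) tip R)) l.

Definition w (l0 l1 : {measure set (borel C) -> \bar R}) (k : {nonneg R}) :
    \bar R :=
  WC (add_tip k l0) (add_tip k l1).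

Definition theta (l : {measure set (borel C) -> \bar R}) : R :=
  fine (l (~` [set tip])).

Definition rho (l : {measure set (borel C) -> \bar R}) : R :=
  fine (l [set tip]).

Definition kappa_star_val (l0 l1 : {measure set (borel C) -> \bar R}) : R :=
  (Num.max 0 (Num.max (theta l1 - rho l0) (theta l0 - rho l1)))%R.

Lemma kappa_star_ge0 l0 l1 : (0 <= kappa_star_val l0 l1)%R.
Proof. by rewrite le_max lexx. Qed.

Definition kappa_star (l0 l1 : {measure set (borel C) -> \bar R}) :
    {nonneg R} :=
  NngNum (kappa_star_ge0 l0 l1).

Definition far_pairs : set (C * C) :=
  [set z | exists x0 r0 x1 r1,
    [/\ z = (cone_pt x0 r0, cone_pt x1 r1), (0 < r0%:num)%R, (0 < r1%:num)%R
      & (pi / 2 < enorm (\val x0 - \val x1))%R]].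

End transport.

Arguments M2 {R d Omega} Omega0.
Arguments tip_tip {R d Omega} Omega0.
Arguments far_pairs {R d Omega} Omega0.

(* Main.v *)
(* The tip is where mass can be parked for free.  A plan for [kappa] puts mass
   at most [theta_1] on pairs (tip, z) with z away from the tip, hence mass at
   least [rho_0 + kappa - theta_1 >= kappa - kappa_star] on (tip, tip), where the
   cost vanishes.  So adding and removing [(kappa - kappa_star) delta_(tip, tip)]
   are mutually inverse, cost-preserving bijections between the plans for
   [kappa_star] and those for [kappa].  On a far pair the cost exceeds
   [r_0^2 + r_1^2], the cost of sending both points to the tip separately;
   rerouting the far pairs through the tip raises [kappa_star] by the rerouted
   mass, which can be removed again, so an optimal plan has no far pairs. *)
Require Import Defs.
From mathcomp Require Import all_boot all_order all_algebra.
From mathcomp Require Import all_classical all_reals all_analysis.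
From mathcomp Require Import measurable_realfun ring lra.

Set Implicit Arguments.
Unset Strict Implicit.
Unset Printing Implicit Defensive.

Import Order.TTheory GRing.Theory Num.Theory.
Import numFieldNormedType.Exports.

Local Open Scope classical_set_scope.
Local Open Scope ring_scope.
Local Notation radius := Defs.radius.

(** * Measurability of maps between Borel spaces *)

Section borel_sets.
Context {R : realType}.

(** Preimages of generators suffice. With open sets as generators this turns continuity into
    measurability on [borel (C * C)], whose sigma-algebra is generated by the open sets of the
    product and not by rectangles. *)
Lemma measurable_fun_open (T U : pointedType) (O : set (set T)) (P : set (set U))
    (f : T -> U) : (forall B, P B -> O (f @^-1` B)) ->
  measurable_fun setT (f : g_sigma_algebraType O -> g_sigma_algebraType P).
Proof.
move=> fO.
refine (@measurability _ _ (g_sigma_algebraType O) (g_sigma_algebraType P)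
  setT f P erefl _).
by move=> _ [B PB <-]; rewrite setTI; apply: sub_sigma_algebra; exact: fO.
Qed.

Lemma measurable_fun_open_real (T : pointedType) (O : set (set T)) (f : T -> R) :
  (forall B, open B -> O (f @^-1` B)) ->
  measurable_fun setT (f : g_sigma_algebraType O -> R).
Proof.
move=> fO.
refine (@measurability _ _ (g_sigma_algebraType O) R setT f _
  (RGenOpens.measurableE R) _).
move=> _ [_ [a [b ->] <-]]; rewrite setTI; apply: sub_sigma_algebra.
exact/fO/interval_open.
Qed.

End borel_sets.

(** Restricting to the whole space changes no value and supplies the finite-measure structure that
    plans must carry. *)
Lemma finite_measureP {disp} {T : measurableType disp} {R : realType}
    (m : {measure set T -> \bar R}) : (m setT < +oo)%E ->
  exists m' : {finite_measure set T -> \bar R}, forall A, m' A = m A.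
Proof.
move=> moo; exists (mfrestr measurableT moo) => A.
by rewrite /= /mfrestr /mrestr setIT.
Qed.

(** * Adding and removing a point mass *)

Section point_mass.
Context {disp : measure_display} {T : measurableType disp} {R : realType}.
Variable a : T.
Local Open Scope ereal_scope.
Implicit Types (m : {measure set T -> \bar R}) (c : {nonneg R}).

Definition add_dirac c m : {measure set T -> \bar R} :=
  measure_add m (mscale c (dirac a)).

Lemma add_diracE c m A : add_dirac c m A = m A + c%:num%:E * \d_a A.
Proof. exact: measure_addE. Qed.

Lemma ge0_integral_add_dirac c m (f : T -> \bar R) :
  measurable_fun setT f -> (forall x, 0 <= f x) ->
  \int[add_dirac c m]_x f x = \int[m]_x f x + c%:num%:E * f a.
Proof.
move=> mf f0; rewrite ge0_integral_measure_add// ge0_integral_mscale//.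
by rewrite integral_dirac// diracT mul1e.
Qed.

Lemma exists_add_dirac c (m : {finite_measure set T -> \bar R}) :
  exists m' : {finite_measure set T -> \bar R}, same_measure m' (add_dirac c m).
Proof.
have [|m' m'E] := @finite_measureP _ T R (add_dirac c m).
  rewrite add_diracE lte_add_pinfty ?lte_mul_pinfty// ?diracE ?ltry//.
  by rewrite ltey_eq fin_num_measure.
by exists m' => A _.
Qed.

(** The witness discards the atom at [a] and puts back a point mass of weight [m [set a] - c], which
    is nonnegative by assumption. *)
Lemma exists_sub_dirac c (m : {finite_measure set T -> \bar R}) :
  measurable [set a] -> c%:num%:E <= m [set a] ->
  exists m' : {finite_measure set T -> \bar R}, same_measure m (add_dirac c m').
Proof.
move=> ma cm; have mfin : m [set a] \is a fin_num by rewrite fin_num_measure.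
have r0 : (0 <= fine (m [set a]) - c%:num)%R by rewrite subr_ge0 -lee_fin fineK.
have [m' m'E] := exists_add_dirac (NngNum r0)
  (mrestr m (measurableC ma) : {finite_measure set T -> \bar R}).
exists m' => A mA; rewrite add_diracE/= m'E// add_diracE/= /mrestr.
rewrite -addeA -muleDl// -EFinD subrK fineK// (measureDI m mA ma).
(* The remaining term is the mass of [A] at [a]: the whole atom or nothing. *)
congr (_ + _); rewrite diracE; have [Aa|nAa] := pselect (A a).
  by rewrite mem_set// mule1; congr (m _); apply/setIidr => _ ->.
rewrite memNset// mule0 (_ : _ `&` _ = set0) ?measure0//.
by apply/seteqP; split=> [z [Az za]|//]; apply: nAa; rewrite -za.
Qed.

End point_mass.

(** * Image measures, restrictions and a strict comparison of integrals *)

Section integration.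
Context {disp disp' : measure_display} {T : measurableType disp}
  {U : measurableType disp'} {R : realType}.
Local Open Scope ereal_scope.
Implicit Types m : {measure set T -> \bar R}.

Definition image_measure (f : T -> U) (mf : measurable_fun setT f) m :
  {measure set U -> \bar R} := ltac:(refine (pushforward m f); exact: mf).

Lemma ge0_integral_image_measure f (mf : measurable_fun setT f) m
    (h : U -> \bar R) : measurable_fun setT h -> (forall x, 0 <= h x) ->
  \int[image_measure mf m]_y h y = \int[m]_x h (f x).
Proof.
move=> mh h0.
by rewrite [LHS](ge0_integral_pushforward mf)// preimage_setT.
Qed.

Lemma ge0_integral_mrestr m (N : set T) (mN : measurable N) (f : T -> \bar R) :
  measurable_fun setT f -> (forall x, 0 <= f x) ->
  \int[mrestr m mN]_x f x = \int[m]_(x in N) f x.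
Proof.
move=> mf f0; have mNC := measurableC mN.
rewrite -(setUv N) ge0_integral_setU//; last first.
  by rewrite disj_set2E setICr.
  by rewrite setUv.
rewrite (null_set_integral (N := ~` N))//; last first.
- by rewrite /= /mrestr setICl measure0.
- exact: measurable_funS mf.
rewrite adde0; apply: eq_measure_integral => A mA AN.
by rewrite /= /mrestr setIidl.
Qed.

(** Finiteness of the integral of [h] allows subtraction: the positive function [f - h] has integral
    zero over [N], which forces [N] to be null. *)
Lemma null_set_lt_integral m (N : set T) (f h : T -> R) : measurable N ->
  measurable_fun N f -> measurable_fun N h -> (forall x, N x -> (0 <= h x)%R) ->
  (forall x, N x -> (h x < f x)%R) ->
  \int[m]_(x in N) (h x)%:E < +oo ->
  \int[m]_(x in N) (f x)%:E <= \int[m]_(x in N) (h x)%:E -> m N = 0.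
Proof.
move=> mN mf mh h0 hf hoo fh.
pose e := (f \- h)%R; have me : measurable_fun N (EFin \o e).
  by apply/measurable_EFinP; exact: measurable_funB.
have e0 x : N x -> (0 < e x)%R by move=> Nx; rewrite subr_gt0 hf.
have hfin : \int[m]_(x in N) (h x)%:E \is a fin_num.
  by rewrite ge0_fin_numE// integral_ge0// => x Nx; rewrite lee_fin h0.
have ie0 : \int[m]_(x in N) (e x)%:E = 0.
  apply/eqP; rewrite eq_le; apply/andP; split; last first.
    by apply: integral_ge0 => x Nx; rewrite lee_fin ltW// e0.
  rewrite -(leeD2lE _ _ hfin) adde0; apply: le_trans fh.
  rewrite -ge0_integralD//; first last.
  - by move=> x Nx; rewrite lee_fin ltW// e0.
  - exact/measurable_EFinP.
  rewrite (eq_integral (fun x => (f x)%:E))// => x _.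
  by rewrite -EFinD /e/= addrC subrK.
(* A zero integral makes [e] vanish almost everywhere on [N]; since [e] is positive there, the
   exceptional null set [A] contains all of [N]. *)
have [/(_ _)] := ae_eq_integral_abs m mN me.
rewrite (eq_integral (fun x => (e x)%:E)) =>
  [/(_ ie0) [A [mA mA0 NA]] _|x]; last first.
  by rewrite inE => Nx; rewrite /= ger0_norm// ltW// e0.
apply/eqP; rewrite eq_le measure_ge0 andbT -mA0.
apply: le_measure; rewrite ?inE// => x Nx; apply: NA => /= /(_ Nx) [ex0].
by have := e0 _ Nx; rewrite ex0 ltxx.
Qed.

End integration.

(** * Continuity on the cone and the geometry of far pairs *)

Section cone_metric.
Context {R : realType} {d : nat} {Omega : set 'rV[R]_d}
  {Omega0 : Omega !=set0}.
Local Notation C := (cone Omega0).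
Implicit Types z : C.

Lemma cone_dist_tip z : cone_dist z tip = radius z.
Proof.
have [x [r ->]] := cone_ptP z; rewrite (tipE x) radiusE cone_distE.
rewrite /cone_sqdist/= mulr0 mul0r subr0 expr0n/= addr0 sqrtr_sqr.
exact: ger0_norm.
Qed.

Lemma cone_tip_dist z : cone_dist tip z = radius z.
Proof. by rewrite cone_dist_sym cone_dist_tip. Qed.

(** Moving the endpoints changes the distance by at most the sum of the two displacements; each sign
    of the difference takes two triangle inequalities. *)
Lemma cone_dist_continuous : continuous (fun z : C * C => cone_dist z.1 z.2).
Proof.
move=> [a b]; apply/cvgrPdist_lt => /= e e0.
near=> z.
have ha : cone_dist a z.1 < e / 2.
  near: z; apply: (@cvg_fst _ _ (nbhs a) (nbhs b) _ [set x | cone_dist a x < e / 2]).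
  apply/(@metricType_numDomainType.nbhs_mdistP _ C).
  by exists (e / 2) => //=; rewrite divr_gt0.
have hb : cone_dist b z.2 < e / 2.
  near: z; apply: (@cvg_snd _ _ (nbhs a) (nbhs b) _ [set x | cone_dist b x < e / 2]).
  apply/(@metricType_numDomainType.nbhs_mdistP _ C).
  by exists (e / 2) => //=; rewrite divr_gt0.
have := cone_dist_triangle z.1 a b.
have := cone_dist_triangle z.2 z.1 b.
have := cone_dist_triangle a z.1 z.2.
have := cone_dist_triangle b a z.2.
rewrite (cone_dist_sym z.1 a) (cone_dist_sym z.2 b) => h1 h2 h3 h4.
rewrite ltr_norml; apply/andP; split; lra.
Unshelve. all: by end_near.
Qed.

Lemma radius_continuous : continuous (radius : C -> R).
Proof.
move=> a; apply/(@cvgrPdist_lt _ _ _ (nbhs a) (nbhs_filter a)) => /= e e0.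
near=> z.
have az : cone_dist a z < e.
  by near: z; apply/(@metricType_numDomainType.nbhs_mdistP _ C); exists e.
have := cone_dist_triangle z a tip; have := cone_dist_triangle a z tip.
rewrite !cone_dist_tip (cone_dist_sym z a) => h1 h2.
by rewrite ltr_norml; apply/andP; split; lra.
Unshelve. all: by end_near.
Qed.

(** The cosine decreases strictly on [[0, pi]] and vanishes at [pi / 2]; truncating at [pi] does not
    affect which side of [pi / 2] the argument lies on. *)
Lemma cos_pi_lt0 (L : R) : 0 <= L -> (cos_pi L < 0) = (pi / 2 < L).
Proof.
move=> L0; have p0 := pi_gt0 R; rewrite /cos_pi; apply/idP/idP; last first.
  move=> pL; rewrite -(@cos_pihalf R) ltr_cos ?in_itv/=;
    have [Lp|Lp] := leP L pi; try (apply/andP; split); lra.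
apply: contraTT; rewrite -!leNgt => Lp; rewrite min_l; last by lra.
by apply: cos_ge0_pihalf; apply/andP; split; lra.
Qed.

(** The excess of the squared distance over the two squared radii is [- 2 r s cos_pi L]. This form
    avoids representatives; it yields both measurability and the strict gain from passing through
    the tip. *)
Lemma far_pairsE : far_pairs Omega0 =
  [set z | radius z.1 ^+ 2 + radius z.2 ^+ 2 < cone_dist z.1 z.2 ^+ 2].
Proof.
apply/seteqP; split=> [_ [x [r [y [s [-> r0 s0 xy]]]]]|[a b]] /=.
  rewrite !radiusE sqr_cone_distE -subr_gt0.
  rewrite (_ : _ - _ = (2 * r%:num * s%:num) *
    - cos_pi (enorm (\val x - \val y))); last by ring.
  by rewrite mulr_gt0 ?mulr_gt0// oppr_gt0 cos_pi_lt0 ?enorm_ge0.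
have [x [r ->]] := cone_ptP a; have [y [s ->]] := cone_ptP b.
rewrite !radiusE sqr_cone_distE -subr_gt0 => H.
exists x, r, y, s.
(* If the product of the radii vanished, so would the excess, against [H]. *)
have rs : 0 < r%:num * s%:num.
  rewrite lt_neqAle mulr_ge0// andbT eq_sym; apply: contraTneq H => rs.
  by rewrite -leNgt -!mulrA !(mulrA r%:num) rs; lra.
have r0 : 0 < r%:num.
  rewrite lt_neqAle eq_sym ge0 andbT.
  by apply: contraTneq rs => ->; rewrite mul0r ltxx.
have s0 : 0 < s%:num.
  by rewrite -(pmulr_rgt0 _ r0).
split => //; rewrite -cos_pi_lt0 ?enorm_ge0//.
rewrite -(pmulr_rlt0 _ rs); lra.
Qed.

End cone_metric.

(** * Measurability on the cone, and plans under a change of mass at the tip *)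

Section cone_plans.
Context {R : realType} {d : nat} {Omega : set 'rV[R]_d}
  {Omega0 : Omega !=set0}.
Local Notation C := (cone Omega0).
Local Notation bC := (borel C).
Local Notation bCC := (borel (C * C)).
Local Open Scope ereal_scope.

Local Notation fst := (fst : bCC -> bC).
Local Notation snd := (snd : bCC -> bC).

Lemma measurable_borel_fst : measurable_fun setT fst.
Proof.
apply: measurable_fun_open; apply/continuousP => z; exact: cvg_fst.
Qed.

Lemma measurable_borel_snd : measurable_fun setT snd.
Proof.
apply: measurable_fun_open; apply/continuousP => z; exact: cvg_snd.
Qed.

(** This map and its mirror image below are the ones along which mass is later rerouted through the
    tip. *)
Lemma measurable_fst_tip :
  measurable_fun setT ((fun z => (z.1, tip)) : bCC -> bCC).
Proof.
apply: (@measurable_fun_open (C * C)%type (C * C)%type); apply/continuousP => z.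
exact: (@cvg_pair _ _ _ (nbhs z) (nbhs z.1) (nbhs tip) _ _ _ _ (@cst _ C tip)
  (@cvg_fst _ _ (nbhs z.1) (nbhs z.2) _) (cvg_cst _)).
Qed.

Lemma measurable_tip_snd :
  measurable_fun setT ((fun z => (tip, z.2)) : bCC -> bCC).
Proof.
apply: (@measurable_fun_open (C * C)%type (C * C)%type); apply/continuousP => z.
exact: (@cvg_pair _ _ _ (nbhs z) (nbhs tip) (nbhs z.2) _ _ _ (@cst _ C tip) _
  (cvg_cst _) (@cvg_snd _ _ (nbhs z.1) (nbhs z.2) _)).
Qed.

Lemma measurable_radius : measurable_fun setT (radius : bC -> R).
Proof.
by apply: measurable_fun_open_real; apply/continuousP; exact: radius_continuous.
Qed.

Lemma measurable_cone_dist :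
  measurable_fun setT ((fun z => cone_dist (z.1 : C) (z.2 : C)) : bCC -> R).
Proof.
apply: (@measurable_fun_open_real _ (C * C)%type); apply/continuousP.
exact: cone_dist_continuous.
Qed.

Lemma measurable_sqr_radius :
  measurable_fun setT ((fun z => (radius (z : C) ^+ 2)%:E) : bC -> \bar R).
Proof.
by apply/measurable_EFinP; apply: measurable_funX; exact: measurable_radius.
Qed.

Lemma measurable_sqr_cone_dist : measurable_fun setT
  ((fun z => (cone_dist (z.1 : C) (z.2 : C) ^+ 2)%:E) : bCC -> \bar R).
Proof.
by apply/measurable_EFinP; apply: measurable_funX; exact: measurable_cone_dist.
Qed.

Lemma measurable_tip : measurable ([set tip] : set bC).
Proof.
rewrite (_ : [set tip] = [set: bC] `&` (radius : bC -> R) @^-1` [set 0%R]).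
  exact: measurable_radius.
by rewrite setTI; apply/seteqP; split=> z /= /tipP.
Qed.

Lemma measurable_preimage_fst (A : set bC) :
  measurable A -> measurable (fst @^-1` A).
Proof.
by move=> mA; rewrite -[X in measurable X]setTI; exact: measurable_borel_fst.
Qed.

Lemma measurable_preimage_snd (A : set bC) :
  measurable A -> measurable (snd @^-1` A).
Proof.
by move=> mA; rewrite -[X in measurable X]setTI; exact: measurable_borel_snd.
Qed.

Lemma measurable_tip_tip : measurable [set tip_tip Omega0].
Proof.
rewrite (_ : [set _] = fst @^-1` [set tip] `&` snd @^-1` [set tip]).
  apply: measurableI; [apply: measurable_preimage_fst|
    apply: measurable_preimage_snd]; exact: measurable_tip.
by apply/seteqP; split=> [_ ->//|[a b] /= [-> ->]].
Qed.

Lemma measurable_far_pairs : measurable (far_pairs Omega0 : set bCC).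
Proof.
rewrite far_pairsE.
pose f := (fun z => radius (z.1 : C) ^+ 2 + radius (z.2 : C) ^+ 2)%R : bCC -> R.
pose g := (fun z => cone_dist (z.1 : C) (z.2 : C) ^+ 2)%R : bCC -> R.
have mf : measurable_fun setT f.
  apply: measurable_funD; apply: measurable_funX.
    exact: (measurableT_comp measurable_radius measurable_borel_fst).
  exact: (measurableT_comp measurable_radius measurable_borel_snd).
have mg : measurable_fun setT g.
  by apply: measurable_funX; exact: measurable_cone_dist.
rewrite -[X in measurable X]setTI.
exact: (@measurable_fun_ltr _ _ _ _ f g).
Qed.

Implicit Types (g h : {finite_measure set bCC -> \bar R})
  (l : {finite_measure set bC -> \bar R}) (k c : {nonneg R}).

Lemma add_tipE k (l : {measure set bC -> \bar R}) (A : set bC) :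
  add_tip k l A = k%:num%:E * \d_(tip : bC) A + l A.
Proof. exact: measure_addE. Qed.

Lemma cost_same_measure (m m' : {measure set bCC -> \bar R}) :
  same_measure m m' -> cost m = cost m'.
Proof. by move=> mm'; apply: eq_measure_integral => A mA _; exact: mm'. Qed.

Lemma cost_ge0 (m : {measure set bCC -> \bar R}) : 0 <= cost m.
Proof. by apply: integral_ge0 => z _; rewrite lee_fin sqr_ge0. Qed.

Lemma cost_add_dirac c (m m' : {measure set bCC -> \bar R}) :
  same_measure m' (add_dirac (tip_tip Omega0) c m) -> cost m' = cost m.
Proof.
move=> /cost_same_measure ->; rewrite /cost ge0_integral_add_dirac.
- by rewrite /= cone_distxx expr0n/= mule0 adde0.
- exact: measurable_sqr_cone_dist.
- by move=> z; rewrite lee_fin sqr_ge0.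
Qed.

(** Both projections send (tip, tip) to the tip, so each marginal gains [c] there, exactly the step
    from [k] to [k']. The relation between [g] and [h] is symmetric enough to serve for adding as
    well as for removing the atom. *)
Lemma plans_add_dirac (l l' : {finite_measure set bC -> \bar R}) g h k k' c :
  (k%:num + c%:num = k'%:num)%R ->
  same_measure h (add_dirac (tip_tip Omega0) c g) ->
  plans (add_tip k' l) (add_tip k' l') h <->
  plans (add_tip k l) (add_tip k l') g.
Proof.
move=> kck' hg.
have marginal (f : bCC -> bC) (m : {finite_measure set bC -> \bar R}) :
    measurable_fun setT f -> f (tip_tip Omega0) = tip ->
    same_measure (pushforward h f) (add_tip k' m) <->
    same_measure (pushforward g f) (add_tip k m).
  move=> mf ft.
  suff H A : measurable A -> (h (f @^-1` A) = add_tip k' m A) <->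
                             (g (f @^-1` A) = add_tip k m A).
    by split=> E A mA; apply/(H A mA); exact: E.
  move=> mA; have mfA : measurable (f @^-1` A).
    by rewrite -[X in measurable X]setTI; exact: mf.
  rewrite !add_tipE hg// add_diracE/=.
  (* All masses are finite, so the claim becomes one about reals, where the added term cancels in
     both directions. *)
  rewrite -(fineK (fin_num_measure g _ mfA)) -(fineK (fin_num_measure m _ mA)).
  rewrite !diracE (_ : (_ \in f @^-1` A) = (tip \in A)); last first.
    by rewrite -[in RHS]ft; apply/idP/idP => /set_mem ?; exact/mem_set.
  rewrite -kck' -!EFinM -!EFinD.
  by split=> -[] E; congr EFin; move: E; case: (tip \in A) => /=; lra.
split=> -[p q]; split.
- exact/(marginal _ _ measurable_borel_fst erefl).
- exact/(marginal _ _ measurable_borel_snd erefl).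
- exact/(marginal _ _ measurable_borel_fst erefl).
- exact/(marginal _ _ measurable_borel_snd erefl).
Qed.

(** Mass [k + rho l] starts at the tip, and at most [theta l'] of it can end elsewhere; the rest
    stays on (tip, tip). *)
Lemma le_plan_tip_tip (l l' : {finite_measure set bC -> \bar R}) h k :
  plans (add_tip k l) (add_tip k l') h ->
  (k%:num - kappa_star_val l l')%:E <= h [set tip_tip Omega0].
Proof.
move=> [p q]; have mt := measurable_tip; have mnt := measurableC mt.
have := p _ mt; have := q _ mnt; rewrite /pushforward !add_tipE !diracE/=.
have mF := measurable_preimage_fst mt; have mS := measurable_preimage_snd mnt.
rewrite (memNset (A := ~` _)); last by apply.
rewrite (mem_set (A := [set _]))// mule0 add0e mule1 => hS hF.
have hle : h (fst @^-1` [set tip]) <=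
    h (snd @^-1` (~` [set tip])) + h [set tip_tip Omega0].
  rewrite (le_trans _ (measureU2 h mS measurable_tip_tip))//.
  rewrite le_measure ?inE//; first exact: measurableU measurable_tip_tip.
  move=> [a b] /= ->; have [->|] := pselect (b = tip); [by right|by left].
move: hle; rewrite hF hS /kappa_star_val /theta /rho.
rewrite -(fineK (fin_num_measure h _ measurable_tip_tip)).
rewrite -(fineK (fin_num_measure l _ mt)) -(fineK (fin_num_measure l' _ mnt)).
rewrite -!EFinD !lee_fin => hle; rewrite lerBlDr -lerBlDl.
(* The entry of the maximum that matches [hle] is [theta l' - rho l]. *)
rewrite !le_max; apply/orP; right; apply/orP; left => /=; lra.
Qed.

End cone_plans.

(** * Cost bounds and rerouting through the tip *)

Section reroute.
Context {R : realType} {d : nat} {Omega : set 'rV[R]_d}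
  {Omega0 : Omega !=set0}.
Local Notation C := (cone Omega0).
Local Notation bC := (borel C).
Local Notation bCC := (borel (C * C)).
Local Open Scope ereal_scope.
Implicit Types (g h : {finite_measure set bCC -> \bar R})
  (l : {finite_measure set bC -> \bar R}) (k : {nonneg R}).

Let sqr1 (z : bCC) : \bar R := (radius (z.1 : C) ^+ 2)%:E.
Let sqr2 (z : bCC) : \bar R := (radius (z.2 : C) ^+ 2)%:E.
Let sqd (z : bCC) : \bar R := (cone_dist (z.1 : C) (z.2 : C) ^+ 2)%:E.

Lemma measurable_sqr_radius_fst : measurable_fun setT sqr1.
Proof. exact: (measurableT_comp measurable_sqr_radius measurable_borel_fst). Qed.

Lemma measurable_sqr_radius_snd : measurable_fun setT sqr2.
Proof. exact: (measurableT_comp measurable_sqr_radius measurable_borel_snd). Qed.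

Lemma ge0_integral_add_tip k l (f : bC -> \bar R) :
  measurable_fun setT f -> (forall z, 0 <= f z) -> f tip = 0 ->
  \int[add_tip k l]_z f z = \int[l]_z f z.
Proof.
move=> mf f0 ft; rewrite ge0_integral_measure_add// ge0_integral_mscale//.
by rewrite integral_dirac// ft !mule0 add0e.
Qed.

(** The squared radius vanishes at the tip, so second moments do not see the mass [k] added
    there. *)
Lemma integral_sqr_radius_marginal k l (p : bCC -> bC) g :
  measurable_fun setT p -> same_measure (pushforward g p) (add_tip k l) ->
  \int[g]_z (radius (p z : C) ^+ 2)%:E = \int[l]_z (radius (z : C) ^+ 2)%:E.
Proof.
move=> mp gp.
have r0 (z : bC) : 0 <= (radius (z : C) ^+ 2)%:E by rewrite lee_fin sqr_ge0.
rewrite -(ge0_integral_image_measure mp g measurable_sqr_radius r0).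
rewrite (eq_measure_integral (add_tip k l)) => [|A mA _]; last exact: gp.
apply: ge0_integral_add_tip => //; first exact: measurable_sqr_radius.
by have /tipP -> : (tip : C) = tip by []; rewrite expr0n.
Qed.

Lemma sqr_cone_dist_le (z0 z1 : C) :
  (cone_dist z0 z1 ^+ 2 <= 2 * radius z0 ^+ 2 + 2 * radius z1 ^+ 2)%R.
Proof.
have := cone_dist_triangle tip z0 z1; rewrite cone_dist_tip cone_tip_dist => h.
have d0 : (0 <= cone_dist z0 z1)%R by rewrite -mdist_coneE mdist_ge0.
have r0 := radius_ge0 z0; have r1 := radius_ge0 z1.
have := sqr_ge0 (radius z0 - radius z1); nra.
Qed.

(** The triangle inequality through the tip bounds the cost by twice the sum of the second moments
    of the marginals. Finiteness is what later permits cancelling the cost off the far pairs. *)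
Lemma cost_lty k l l' g : M2 Omega0 l -> M2 Omega0 l' ->
  plans (add_tip k l) (add_tip k l') g -> cost g < +oo.
Proof.
move=> lM l'M [p q].
have s10 z : 0 <= sqr1 z by rewrite lee_fin sqr_ge0.
have s20 z : 0 <= sqr2 z by rewrite lee_fin sqr_ge0.
have m1 := measurable_sqr_radius_fst; have m2 := measurable_sqr_radius_snd.
have i1 := integral_sqr_radius_marginal measurable_borel_fst p.
have i2 := integral_sqr_radius_marginal measurable_borel_snd q.
apply: (@le_lt_trans _ _ (\int[g]_z (2%:E * sqr1 z + 2%:E * sqr2 z))).
  apply: ge0_le_integral => //.
  - by move=> z _; rewrite lee_fin sqr_ge0.
  - exact: measurable_sqr_cone_dist.
  - by apply: emeasurable_funD; exact: measurable_funeM.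
  - by move=> z _; rewrite lee_fin sqr_cone_dist_le.
rewrite ge0_integralD//; last 4 first.
- by move=> z _; rewrite mule_ge0.
- exact: measurable_funeM.
- by move=> z _; rewrite mule_ge0.
- exact: measurable_funeM.
rewrite !ge0_integralZl// i1 i2.
by rewrite lte_add_pinfty// lte_mul_pinfty.
Qed.

Section via_tip.
Variables (N : set bCC) (mN : measurable N).

(** Each pair (z0, z1) in [N] is replaced by the two pairs (z0, tip) and (tip, z1), both with its
    full mass, so the total mass grows by [g N]. *)
Definition via_tip g : {measure set bCC -> \bar R} :=
  measure_add (mrestr g (measurableC mN))
   (measure_add (image_measure measurable_fst_tip (mrestr g mN))
                (image_measure measurable_tip_snd (mrestr g mN))).

Lemma via_tipE g (A : set bCC) : via_tip g A =
  g (A `&` ~` N) + (g ((fun z => (z.1, tip) : bCC) @^-1` A `&` N) +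
                    g ((fun z => (tip, z.2) : bCC) @^-1` A `&` N)).
Proof.
rewrite [LHS]measure_addE; congr (_ + _); exact: measure_addE.
Qed.

Lemma cost_via_tip g : cost (via_tip g) =
  \int[g]_(z in ~` N) sqd z + \int[g]_(z in N) (sqr1 z + sqr2 z).
Proof.
have md := @measurable_sqr_cone_dist _ _ _ Omega0.
have d0 z : 0 <= sqd z by rewrite lee_fin sqr_ge0.
have d0T z : [set: bCC] z -> 0 <= sqd z by [].
rewrite [LHS](ge0_integral_measure_add _ _ measurableT d0T)//; congr (_ + _).
  exact: ge0_integral_mrestr.
rewrite [LHS](ge0_integral_measure_add _ _ measurableT d0T)//.
rewrite !ge0_integral_image_measure// !ge0_integral_mrestr//; last first.
- exact: (measurableT_comp md measurable_fst_tip).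
- exact: (measurableT_comp md measurable_tip_snd).
rewrite ge0_integralD//; last 4 first.
- by move=> z _; rewrite lee_fin sqr_ge0.
- exact: measurable_funS measurable_sqr_radius_fst.
- by move=> z _; rewrite lee_fin sqr_ge0.
- exact: measurable_funS measurable_sqr_radius_snd.
congr (_ + _); apply: eq_integral => z _.
  by rewrite /sqd /sqr1 /= cone_dist_tip.
by rewrite /sqd /sqr2 /= cone_tip_dist.
Qed.

(** In each marginal one image measure restores the mass taken from [N], while the other, with that
    coordinate collapsed, adds [g N] at the tip. *)
Lemma plans_via_tip k k' l l' g h : (k'%:num%:E = k%:num%:E + g N) ->
  same_measure h (via_tip g) ->
  plans (add_tip k l) (add_tip k l') g ->
  plans (add_tip k' l) (add_tip k' l') h.
Proof.
move=> kk' hg [p q].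
(* The collapsed coordinate is constantly the tip, so a preimage is everything or empty. *)
have tipN (A : set bC) : g ([set _ | A tip] `&` N) = g N * \d_(tip : bC) A.
  rewrite diracE; have [At|nAt] := pselect (A tip).
    rewrite mem_set// mule1; congr (g _).
    by apply/seteqP; split=> [z []|z].
  rewrite memNset// mule0 (_ : _ `&` _ = set0) ?measure0//.
  by apply/seteqP; split=> [z []|].
have kE A : k'%:num%:E * \d_(tip : bC) A =
    k%:num%:E * \d_(tip : bC) A + g N * \d_(tip : bC) A.
  by rewrite kk' ge0_muleDl.
split=> A mA; rewrite /pushforward hg; [|exact: measurable_preimage_fst|
    |exact: measurable_preimage_snd]; rewrite via_tipE add_tipE kE.
- have := p _ mA; rewrite /pushforward add_tipE.
  rewrite (measureDI g (measurable_preimage_fst mA) mN) setDE => E.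
  by rewrite addeA E tipN addeAC.
- have := q _ mA; rewrite /pushforward add_tipE.
  rewrite (measureDI g (measurable_preimage_snd mA) mN) setDE => E.
  by rewrite addeCA E tipN addeCA addeA.
Qed.

End via_tip.
End reroute.

(** * Comparison of optimal plans and vanishing on far pairs *)

Section optimal_plans.
Context {R : realType} {d : nat} {Omega : set 'rV[R]_d}
  {Omega0 : Omega !=set0}.
Local Notation C := (cone Omega0).
Local Notation bC := (borel C).
Local Notation bCC := (borel (C * C)).
Local Open Scope ereal_scope.
Local Notation oo := (tip_tip Omega0).
Variables l l' : {finite_measure set bC -> \bar R}.
Implicit Types (g h : {finite_measure set bCC -> \bar R}) (k c : {nonneg R}).
Local Notation ks := (kappa_star l l').

(** The atom at (tip, tip) has mass at least [k - ks = c], so [c] can be split off. *)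
Lemma exists_plan_kappa_star h k :
  plans (add_tip k l) (add_tip k l') h ->
  forall c, (ks%:num + c%:num = k%:num)%R -> exists g,
    same_measure h (add_dirac oo c g) /\ plans (add_tip ks l) (add_tip ks l') g.
Proof.
move=> hp c kc.
have [|g hg] := @exists_sub_dirac _ _ _ oo c h measurable_tip_tip.
  by apply: le_trans (le_plan_tip_tip hp); rewrite lee_fin -kc /= addrC addKr.
by exists g; split=> //; apply/(plans_add_dirac l l' kc hg).
Qed.

(** Every plan for [k] extends by an atom at (tip, tip) to a plan for [k'] of the same cost, so the
    infimum for [k'] can only be smaller. *)
Lemma w_nonincreasing k k' : (k%:num <= k'%:num)%R -> w l l' k' <= w l l' k.
Proof.
rewrite -subr_ge0 => kk'; have kE : (k%:num + (NngNum kk')%:num = k'%:num)%R.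
  by rewrite /= addrC subrK.
rewrite /w /WC lee_sqrt; last first.
  by apply: le_ereal_inf_tmp => _ [g _ <-]; exact: cost_ge0.
apply: le_ereal_inf_tmp => _ [g gp <-].
have [h hg] := exists_add_dirac oo (NngNum kk') g.
rewrite -(cost_add_dirac hg); apply: ereal_inf_lbound; exists h => //.
exact/(plans_add_dirac l l' kE hg).
Qed.

Lemma w_kappa_star k : (ks%:num <= k%:num)%R -> w l l' k = w l l' ks.
Proof.
move=> ksk; apply/eqP; rewrite eq_le w_nonincreasing//=.
rewrite /w /WC lee_sqrt; last first.
  by apply: le_ereal_inf_tmp => _ [g _ <-]; exact: cost_ge0.
apply: le_ereal_inf_tmp => _ [h hp <-].
have := ksk; rewrite -subr_ge0 => c0.
have [|g [hg gp]] := exists_plan_kappa_star hp (c := NngNum c0).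
  by rewrite /= addrC subrK.
by rewrite (cost_add_dirac hg); apply: ereal_inf_lbound; exists g.
Qed.

(** Competitors on either side are matched at equal cost: upwards by adding the atom, downwards by
    splitting it off. *)
Lemma optimal_plan_add_dirac k c g h : (ks%:num + c%:num = k%:num)%R ->
  same_measure h (add_dirac oo c g) ->
  optimal_plan (add_tip k l) (add_tip k l') h <->
  optimal_plan (add_tip ks l) (add_tip ks l') g.
Proof.
move=> kc hg.
split=> -[p opt]; split.
- exact/(plans_add_dirac l l' kc hg).
- move=> g' g'p; have [h' h'g'] := exists_add_dirac oo c g'.
  rewrite -(cost_add_dirac hg) -(cost_add_dirac h'g'); apply: opt.
  exact/(plans_add_dirac l l' kc h'g').
- exact/(plans_add_dirac l l' kc hg).
- move=> h' h'p; have [g' [h'g' g'p]] := exists_plan_kappa_star h'p kc.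
  rewrite (cost_add_dirac hg) (cost_add_dirac h'g'); exact: opt.
Qed.

Lemma optimal_plan_far_pairs g : M2 Omega0 l -> M2 Omega0 l' ->
  optimal_plan (add_tip ks l) (add_tip ks l') g -> g (far_pairs Omega0) = 0.
Proof.
move=> lM l'M [gp opt].
have mN : measurable (far_pairs Omega0 : set bCC) := measurable_far_pairs.
set N := far_pairs Omega0 in mN *.
have md := @measurable_sqr_cone_dist _ _ _ Omega0.
have m1 := @measurable_sqr_radius_fst _ _ _ Omega0.
have m2 := @measurable_sqr_radius_snd _ _ _ Omega0.
have gN : g N \is a fin_num by rewrite fin_num_measure.
(* The rerouted mass [c] is what the tip must gain in both marginals, hence the parameter
   [k = ks + c]. *)
pose c : {nonneg R} := NngNum (fine_ge0 (measure_ge0 g N)).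
have k0 : (0 <= ks%:num + c%:num)%R by rewrite addr_ge0.
pose k : {nonneg R} := NngNum k0.
have cN : c%:num%:E = g N by rewrite /= fineK.
have [|h hE] := @finite_measureP _ bCC R (via_tip mN g).
  rewrite via_tipE !preimage_setT !setTI.
  by rewrite !lte_add_pinfty// ltey_eq fin_num_measure//; exact: measurableC.
have hp : plans (add_tip k l) (add_tip k l') h.
  apply: (plans_via_tip (mN := mN) _ _ gp); last by move=> A _; exact: hE.
  by rewrite -cN.
(* Removing [c] at (tip, tip) again leaves a competitor of [g] for [ks], with the cost of the
   rerouted plan. *)
have [g' [hg' g'p]] := exists_plan_kappa_star hp (c := c) erefl.
have := opt _ g'p; rewrite -(cost_add_dirac hg').
rewrite (@cost_same_measure _ _ _ _ h (via_tip mN g)) => [|A _]; last exact: hE.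
rewrite cost_via_tip.
pose f (z : bCC) : R := (cone_dist (z.1 : C) (z.2 : C) ^+ 2)%R.
pose r (z : bCC) : R := (radius (z.1 : C) ^+ 2 + radius (z.2 : C) ^+ 2)%R.
have f0 z : 0 <= (f z)%:E by rewrite lee_fin sqr_ge0.
have gE : cost g = \int[g]_(z in ~` N) (f z)%:E + \int[g]_(z in N) (f z)%:E.
  rewrite -ge0_integral_setU//; first by rewrite setvU.
  - exact: measurableC.
  - by rewrite setvU.
  - by rewrite disj_set2E setICl.
have roo : \int[g]_(z in N) (r z)%:E < +oo.
  rewrite /r; under eq_integral do rewrite EFinD.
  have [p q] := gp.
  rewrite ge0_integralD//; last 4 first.
  - by move=> z _; rewrite lee_fin sqr_ge0.
  - exact: measurable_funS m1.
  - by move=> z _; rewrite lee_fin sqr_ge0.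
  - exact: measurable_funS m2.
  apply: lte_add_pinfty.
    apply: le_lt_trans lM.
    rewrite -(integral_sqr_radius_marginal measurable_borel_fst p).
    by apply: ge0_subset_integral => // z _; rewrite lee_fin sqr_ge0.
  apply: le_lt_trans l'M.
  rewrite -(integral_sqr_radius_marginal measurable_borel_snd q).
  by apply: ge0_subset_integral => // z _; rewrite lee_fin sqr_ge0.
have fNC : \int[g]_(z in ~` N) (f z)%:E \is a fin_num.
  rewrite ge0_fin_numE ?integral_ge0//.
  apply: le_lt_trans (cost_lty lM l'M gp).
  by apply: ge0_subset_integral => //; exact: measurableC.
(* The finite cost off [N] cancels. Optimality then bounds the integral of [f] over [N] by that of
   [r], although [r] lies strictly below [f] there. *)
rewrite gE leeD2lE// => fr; apply: (@null_set_lt_integral _ _ _ g N f r) => //.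
- by apply: measurable_funTS; exact/measurable_EFinP.
- apply: measurable_funTS; apply: measurable_funD.
    exact/measurable_EFinP.
  exact/measurable_EFinP.
- by move=> z _; rewrite addr_ge0// sqr_ge0.
- by move=> z; rewrite /N far_pairsE.
Qed.

End optimal_plans.

Theorem proposition3p4 (R : realType) (d : nat) (Omega : set 'rV[R]_d)
    (Omega0 : Omega !=set0)
    (Omega_convex : convex_set (Omega : set (convex_lmodType 'rV[R]_d)))
    (Omega_compact : compact Omega)
    (l0 l1 : {finite_measure set (borel (cone Omega0)) -> \bar R})
    (l0_M2 : M2 Omega0 l0) (l1_M2 : M2 Omega0 l1)
    (l01 : l0 setT = l1 setT) :
  let ks := kappa_star l0 l1 in
  [/\ forall k k' : {nonneg R}, k%:num <= k'%:num ->
        (w l0 l1 k' <= w l0 l1 k)%E,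
      forall k : {nonneg R}, ks%:num <= k%:num ->
        w l0 l1 k = w l0 l1 ks /\
        forall g : {finite_measure
            set (borel (cone Omega0 * cone Omega0)) -> \bar R},
          optimal_plan (add_tip k l0) (add_tip k l1) g <->
          exists2 g' : {finite_measure
              set (borel (cone Omega0 * cone Omega0)) -> \bar R},
            optimal_plan (add_tip ks l0) (add_tip ks l1) g' &
            same_measure g (fun A =>
              g' A + (k%:num - ks%:num)%:E * \d_(tip_tip Omega0) A)%E
    & forall g : {finite_measure
          set (borel (cone Omega0 * cone Omega0)) -> \bar R},
        optimal_plan (add_tip ks l0) (add_tip ks l1) g ->
        g (far_pairs Omega0) = 0%E].
Proof.
move=> ks; split.
- by move=> k k' kk'; exact: w_nonincreasing.
- move=> k ksk; split; first exact: w_kappa_star.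
  have c0 : 0 <= k%:num - ks%:num by rewrite subr_ge0.
  have kc : ks%:num + (NngNum c0)%:num = k%:num by rewrite /= addrC subrK.
  move=> g; split=> [gopt|[g' g'opt gg']].
    have [g' [gg' _]] := exists_plan_kappa_star gopt.1 kc.
    exists g'; first exact/(optimal_plan_add_dirac kc gg').
    by move=> A mA; rewrite gg'// add_diracE.
  have hg : same_measure g (add_dirac (tip_tip Omega0) (NngNum c0) g').
    by move=> A mA; rewrite gg'// add_diracE.
  exact/(optimal_plan_add_dirac kc hg).
- by move=> g; exact: optimal_plan_far_pairs.
Qed.
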